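(* Consider the FROST iterates $\mathbf{x}_k,\mathbf{z}_k$ with step-size vector $\boldsymbol{\alpha}=[\alpha_1,\dots,\alpha_n]^\top$ and largest step-size $\overline{\alpha}=\max_i\alpha_i$, with all objects and constants as defined in the context. Define $$a_1=cd\epsilon nl,\quad a_2=d\epsilon nl,\quad a_3=cd\epsilon,\quad a_4=cnl,\quad a_5=yc,\quad a_6=\epsilon\widetilde{y}l\tau cd,\quad a_7=cdnl^2\epsilon\widetilde{y},\quad a_8=dnl^2\epsilon\widetilde{y},\quad a_9=cd\epsilon l\widetilde{y},$$ $\lambda=\max\left(|1-n\boldsymbol{\pi}_r^\top\boldsymbol{\alpha}\mu|,|1-n\boldsymbol{\pi}_r^\top\boldsymbol{\alpha}l|\right)$, and $$\mathbf{t}_k=\begin{bmatrix}\|\mathbf{x}_k-Y_\infty\mathbf{x}_k\|\\ \|Y_\infty\mathbf{x}_k-\mathbf{1}_n\otimes\mathbf{x}^*\|_2\\ \|\mathbf{z}_k-Y_\infty\mathbf{z}_k\|\end{bmatrix},\quad J_{\boldsymbol{\alpha}}=\begin{bmatrix}\sigma+a_1\overline{\alpha}&a_2\overline{\alpha}&a_3\overline{\alpha}\\ a_4\overline{\alpha}&\lambda&a_5\overline{\alpha}\\ a_6+a_7\overline{\alpha}&a_8\overline{\alpha}&\sigma+a_9\overline{\alpha}\end{bmatrix},$$ $$H_k=\begin{bmatrix}\overline{\alpha}d\epsilon\sqrt{n}ry\widetilde{y}^2&0&0\\ \overline{\alpha}\sqrt{n}ry\widetilde{y}^2&0&0\\ d\sqrt{n}r\epsilon\widetilde{y}^2(2+\overline{\alpha}ly\widetilde{y})&0&0\end{bmatrix}\sigma^k,\quad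 \mathbf{s}_k=\begin{bmatrix}\|\nabla\mathbf{f}(\mathbf{x}_k)\|_2\\0\\0\end{bmatrix}.$$ (i) If $\boldsymbol{\pi}_r^\top\boldsymbol{\alpha}<\frac{2}{nl}$, then $\mathbf{t}_{k+1}\le J_{\boldsymbol{\alpha}}\mathbf{t}_k+H_k\mathbf{s}_k$ (entrywise) for all $k\ge 0$. (ii) Let $[\boldsymbol{\pi}_r]_-$ be the smallest element of $\boldsymbol{\pi}_r$. If the largest step-size satisfies $$0<\overline{\alpha}<\min\left\{\frac{\delta_1(1-\sigma)}{a_1\delta_1+a_2\delta_2+a_3\delta_3},\ \frac{(1-\sigma)\delta_3-\delta_1a_6}{a_7\delta_1+a_8\delta_2+a_9\delta_3},\ \frac{1}{nl}\right\}$$ for some positive constants $\delta_1,\delta_2,\delta_3$ such that $$\delta_3>0,\qquad \delta_1<\frac{(1-\sigma)\delta_3}{a_6},\qquad \delta_2>\frac{a_4\delta_1+a_5\delta_3}{\mu n[\boldsymbol{\pi}_r]_-},$$ then the spectral radius of $J_{\boldsymbol{\alpha}}$ is strictly less than $1$.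
   Context: Problem: $n$ agents communicate over a strongly-connected directed graph with vertex set $\{1,\dots,n\}$; $\mathcal{N}_i^{\rm in}$ is the set of in-neighbors of agent $i$ (agents that can send information to $i$), with $i\in\mathcal{N}_i^{\rm in}$. Each agent $i$ has $f_i:\mathbb{R}^p\to\mathbb{R}$, differentiable, with, for constants $l,\mu>0$ and all $\mathbf{x},\mathbf{y}\in\mathbb{R}^p$: $\|\nabla f_i(\mathbf{x})-\nabla f_i(\mathbf{y})\|_2\le l\|\mathbf{x}-\mathbf{y}\|_2$ and $f_i(\mathbf{y})\ge f_i(\mathbf{x})+\nabla f_i(\mathbf{x})^\top(\mathbf{y}-\mathbf{x})+\frac{\mu}{2}\|\mathbf{x}-\mathbf{y}\|_2^2$. Let $F=\frac1n\sum_{i=1}^n f_i$ and let $\mathbf{x}^*$ be its unique minimizer over $\mathbb{R}^p$. Weights: $\underline{A}=\{a_{ij}\}\in\mathbb{R}^{n\times n}$ is row-stochastic with $a_{ij}>0$ if $j\in\mathcal{N}_i^{\rm in}$ and $a_{ij}=0$ otherwise; hence it is primitive. $\boldsymbol{\pi}_r$ is its (positive) left Perron eigenvector, $\boldsymbol{\pi}_r^\top\underline{A}=\boldsymbol{\pi}_r^\top$, normalized by $\boldsymbol{\pi}_r^\top\mathbf{1}_n=1$. (The scalar constants $a_1,\dots,a_9$ in the claim are unrelated to the weights $a_{ij}$.) FROST algorithm: agent $i$ has a step-size $\alpha_i\ge0$; $D=\mathrm{diag}\{\boldsymbol{\alpha}\}\otimes I_p$, $A=\underline{A}\otimes I_p$,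 $\underline{Y}_0=I_n$, $\underline{Y}_{k+1}=\underline{A}\,\underline{Y}_k$, $Y_k=\underline{Y}_k\otimes I_p$, and $\widetilde{Y}_k=\mathrm{diag}(Y_k)$ is the diagonal matrix formed by the diagonal of $Y_k$ (it is invertible). For $\mathbf{x}=(\mathbf{x}^1,\dots,\mathbf{x}^n)\in\mathbb{R}^{np}$ let $\nabla\mathbf{f}(\mathbf{x})\in\mathbb{R}^{np}$ be the stacking of $\nabla f_1(\mathbf{x}^1),\dots,\nabla f_n(\mathbf{x}^n)$. With $\mathbf{x}_0\in\mathbb{R}^{np}$ arbitrary and $\mathbf{z}_0=\nabla\mathbf{f}(\mathbf{x}_0)$, $$\mathbf{x}_{k+1}=A\mathbf{x}_k-D\mathbf{z}_k,\qquad \mathbf{z}_{k+1}=A\mathbf{z}_k+\widetilde{Y}_{k+1}^{-1}\nabla\mathbf{f}(\mathbf{x}_{k+1})-\widetilde{Y}_k^{-1}\nabla\mathbf{f}(\mathbf{x}_k).$$ Constants: $Y_\infty=\lim_k Y_k=(\mathbf{1}_n\boldsymbol{\pi}_r^\top)\otimes I_p$; $\tau=\|A-I_{np}\|_2$; $\epsilon=\|I_{np}-Y_\infty\|_2$; $y=\sup_k\|Y_k\|_2$; $\widetilde{y}=\sup_k\|\widetilde{Y}_k^{-1}\|_2$. $\|\cdot\|_2$ is the Euclidean (spectral) norm. $\|\cdot\|$ is a fixed vector norm on $\mathbb{R}^{np}$ and $\sigma\in(0,1)$ a constant such that $\|A\mathbf{a}-Y_\infty\mathbf{a}\|\le\sigma\|\mathbf{a}-Y_\infty\mathbf{a}\|$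 for all $\mathbf{a}\in\mathbb{R}^{np}$ (such a norm exists). $r>0$ is a constant with $\|Y_k-Y_\infty\|_2\le r\sigma^k$ for all $k\ge0$. $c,d>0$ are constants with $\|\cdot\|_2\le c\|\cdot\|$ and $\|\cdot\|\le d\|\cdot\|_2$ on $\mathbb{R}^{np}$. *)

(* Defs.v *)
From HB Require Import structures.
From mathcomp Require Export all_boot all_order all_algebra.
From mathcomp Require Export all_classical all_reals all_analysis.
From mathcomp Require Export mxtens complex.

Set Implicit Arguments.
Unset Strict Implicit.
Unset Printing Implicit Defensive.

Export Order.TTheory GRing.Theory Num.Theory.
Export numFieldNormedType.Exports.

#[global] Open Scope classical_set_scope.
#[global] Open Scope ring_scope.

(* The library norm on matrices is the sup norm, hence this Euclidean norm.
   Differentiability does not depend on which of the two is used. *)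
Definition norm2 (R : realType) (m : nat) (v : 'cV[R]_m) : R :=
  Num.sqrt (\sum_i v i 0 ^+ 2).

Definition mxnorm2 (R : realType) (m q : nat) (M : 'M[R]_(m, q)) : R :=
  sup [set norm2 (M *m v) | v in [set v : 'cV[R]_q | norm2 v <= 1]].

Definition is_vector_norm (R : realType) (m : nat) (N : 'cV[R]_m -> R) : Prop :=
  [/\ forall v, 0 <= N v,
      forall v, N v = 0 -> v = 0,
      forall (a : R) v, N (a *: v) = `|a| * N v
    & forall u v, N (u + v) <= N u + N v].

Definition spectral_radius (R : realType) (m : nat) (M : 'M[R]_m) : R :=
  sup [set Normc.normc z | z in
        [set z : complex R | eigenvalue (map_mx (real_complex R) M) z]].

Definition grad (R : realType) (p : nat) (f : 'cV[R]_p -> R) (x : 'cV[R]_p) :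
  'cV[R]_p := \col_j 'D_(delta_mx j 0) f x.

(* In R^(np), coordinate j of block i has index mxtens_index (i, j), which is
   the indexing used by the Kronecker product *t. *)
Definition blk (R : realType) (n p : nat) (x : 'cV[R]_(n * p)) (i : 'I_n) :
  'cV[R]_p := \col_j x (mxtens_index (i, j)) 0.

Definition stack (R : realType) (n p : nat) (v : 'I_n -> 'cV[R]_p) :
  'cV[R]_(n * p) := \col_k v (mxtens_unindex k).1 (mxtens_unindex k).2 0.

Definition gradf (R : realType) (n p : nat) (f : 'I_n -> 'cV[R]_p -> R)
  (x : 'cV[R]_(n * p)) : 'cV[R]_(n * p) :=
  stack (fun i => grad (f i) (blk x i)).

Definition avg_obj (R : realType) (n p : nat) (f : 'I_n -> 'cV[R]_p -> R)
  (x : 'cV[R]_p) : R := n%:R^-1 * \sum_i f i x.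

Definition diag_part (R : realType) (m : nat) (M : 'M[R]_m) : 'M[R]_m :=
  diag_mx (\row_i M i i).

Fixpoint Yu (R : realType) (n : nat) (Au : 'M[R]_n) (k : nat) : 'M[R]_n :=
  if k is k'.+1 then Au *m Yu Au k' else 1%:M.

Definition kronI (R : realType) (n p : nat) (M : 'M[R]_n) : 'M[R]_(n * p) :=
  M *t (1%:M : 'M[R]_p).

Definition Ymx (R : realType) (n p : nat) (Au : 'M[R]_n) (k : nat) :
  'M[R]_(n * p) := kronI p (Yu Au k).

Definition Yt (R : realType) (n p : nat) (Au : 'M[R]_n) (k : nat) :
  'M[R]_(n * p) := diag_part (Ymx p Au k).

(* The limit of Ymx p Au k, in closed form, when pi is the normalized left
   Perron vector of the primitive row-stochastic matrix Au. *)
Definition Yinf (R : realType) (n p : nat) (pi : 'cV[R]_n) : 'M[R]_(n * p) :=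
  kronI p ((const_mx 1 : 'cV[R]_n) *m pi^T).

Fixpoint frost (R : realType) (n p : nat) (Au : 'M[R]_n)
  (f : 'I_n -> 'cV[R]_p -> R) (alpha : 'cV[R]_n) (x0 : 'cV[R]_(n * p))
  (k : nat) : 'cV[R]_(n * p) * 'cV[R]_(n * p) :=
  if k is k'.+1 then
    let: (x, z) := frost Au f alpha x0 k' in
    let x' := kronI p Au *m x - kronI p (diag_mx alpha^T) *m z in
    (x', kronI p Au *m z + invmx (Yt p Au k'.+1) *m gradf f x'
           - invmx (Yt p Au k') *m gradf f x)
  else (x0, gradf f x0).

Definition frost_x (R : realType) (n p : nat) (Au : 'M[R]_n)
  (f : 'I_n -> 'cV[R]_p -> R) (alpha : 'cV[R]_n) (x0 : 'cV[R]_(n * p))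
  (k : nat) := (frost Au f alpha x0 k).1.

Definition frost_z (R : realType) (n p : nat) (Au : 'M[R]_n)
  (f : 'I_n -> 'cV[R]_p -> R) (alpha : 'cV[R]_n) (x0 : 'cV[R]_(n * p))
  (k : nat) := (frost Au f alpha x0 k).2.

Definition col3 (R : realType) (u0 u1 u2 : R) : 'cV[R]_3 :=
  \col_(i < 3) nth 0 [:: u0; u1; u2] i.

(* The arguments are the rows of the matrix. *)
Definition mx33 (R : realType) (r0 r1 r2 : 'cV[R]_3) : 'M[R]_3 :=
  \matrix_(i < 3, j < 3) nth 0 [:: r0; r1; r2] i j 0.

(* The default 0 is harmless for nonnegative entries. *)
Definition max_entry (R : realType) (n : nat) (v : 'cV[R]_n) : R :=
  \big[Num.max/0]_i v i 0.

(* The default 1 is harmless for nonempty vectors with an entry at most 1,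
   in particular for probability vectors. *)
Definition min_entry (R : realType) (n : nat) (v : 'cV[R]_n) : R :=
  \big[Num.min/1]_i v i 0.

(* Main.v *)
Require Import Defs.
From mathcomp Require Import ring lra.

(* Each row of the recursion splits the new error into a contraction part and a
   perturbation.  Averaging with the left Perron vector turns [z k] into
   [Yoo (Yt k)^-1 gradf (x k)], which is geometrically close to the block vector
   with all blocks equal to the sum of the local gradients; a gradient step on the
   average objective, with step-size [n pi^T alpha], is then a contraction by
   [lambda] thanks to co-coercivity.  The gradients enter only through their
   Lipschitz bound and the strong convexity inequality, so no derivative is ever
   computed.  For the spectral radius, [(delta1, delta2, delta3)] is a positive
   vector that the nonnegative matrix [J] strictly decreases. *)

Set Implicit Arguments.
Unset Strict Implicit.
Unset Printing Implicit Defensive.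

(** * Euclidean inner product and norm *)

Section Euclidean.
Variables (R : realType) (m : nat).
Implicit Types (u v w : 'cV[R]_m) (a b : R).

Definition dot u v : R := \sum_i u i 0 * v i 0.

Lemma dotE u v : (u^T *m v) 0 0 = dot u v.
Proof. by rewrite mxE; apply: eq_bigr => i _; rewrite mxE. Qed.

Lemma dotC u v : dot u v = dot v u.
Proof. by apply: eq_bigr => i _; rewrite mulrC. Qed.

Lemma dotDr u v w : dot u (v + w) = dot u v + dot u w.
Proof. by rewrite -big_split; apply: eq_bigr => i _; rewrite mxE mulrDr. Qed.

Lemma dotZr a u v : dot u (a *: v) = a * dot u v.
Proof. by rewrite mulr_sumr; apply: eq_bigr => i _; rewrite mxE mulrCA. Qed.

Lemma dotDl u v w : dot (u + v) w = dot u w + dot v w.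
Proof. by rewrite dotC dotDr !(dotC w). Qed.

Lemma dotZl a u v : dot (a *: u) v = a * dot u v.
Proof. by rewrite dotC dotZr dotC. Qed.

Lemma dotNr u v : dot u (- v) = - dot u v.
Proof. by rewrite -scaleN1r dotZr mulN1r. Qed.

Lemma dotNl u v : dot (- u) v = - dot u v.
Proof. by rewrite dotC dotNr dotC. Qed.

Definition dot_linear := (dotDl, dotDr, dotNl, dotNr, dotZl, dotZr).

Lemma dot_ge0 u : 0 <= dot u u.
Proof. by apply: sumr_ge0 => i _; rewrite -expr2 sqr_ge0. Qed.

Lemma norm2_ge0 u : 0 <= norm2 u.
Proof. exact: sqrtr_ge0. Qed.

Lemma norm2_sqr u : norm2 u ^+ 2 = dot u u.
Proof.
rewrite sqr_sqrtr; last by apply: sumr_ge0 => i _; rewrite sqr_ge0.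
by apply: eq_bigr => i _; rewrite expr2.
Qed.

Lemma norm2_eq0 u : norm2 u = 0 -> u = 0.
Proof.
move=> u0; have /eqP := norm2_sqr u; rewrite u0 expr0n /= eq_sym psumr_eq0.
  move=> /allP z; apply/matrixP => i j; rewrite ord1 mxE; apply/eqP.
  by have := z i; rewrite mem_index_enum mulf_eq0 orbb => /implyP; apply.
by move=> i _; rewrite -expr2 sqr_ge0.
Qed.

Lemma norm2_le_sqr u b : 0 <= b -> dot u u <= b ^+ 2 -> norm2 u <= b.
Proof.
by move=> b0 ub; rewrite -(@ler_pXn2r _ 2) ?nnegrE ?norm2_ge0 // norm2_sqr.
Qed.

Lemma norm20 : norm2 (0 : 'cV[R]_m) = 0.
Proof.
apply/eqP; rewrite eq_le norm2_ge0 andbT norm2_le_sqr //.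
by rewrite /dot big1 ?expr0n // => i _; rewrite mxE mul0r.
Qed.

Lemma norm2Z a u : norm2 (a *: u) = `|a| * norm2 u.
Proof.
apply/eqP; rewrite -(@eqrXn2 _ 2) ?mulr_ge0 ?norm2_ge0 //.
by rewrite exprMn real_normK ?num_real // !norm2_sqr !dot_linear mulrA -expr2.
Qed.

Lemma norm2N u : norm2 (- u) = norm2 u.
Proof. by rewrite -scaleN1r norm2Z normrN1 mul1r. Qed.

Lemma norm2C (u v : 'cV[R]_m) : norm2 (u - v) = norm2 (v - u).
Proof. by rewrite -norm2N opprB. Qed.

(** Cauchy-Schwarz: the square of [norm2 v *: u - norm2 u *: v] expands to twice [norm2 u * norm2 v]
    times the difference of the two sides. If that product vanishes, one of the vectors is zero. *)
Lemma dot_le u v : dot u v <= norm2 u * norm2 v.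
Proof.
have [p0|] := ltrP 0 (norm2 u * norm2 v); last first.
  move=> p0; have := mulr_ge0 (norm2_ge0 u) (norm2_ge0 v).
  rewrite le_eqVlt ltNge p0 orbF eq_sym mulf_eq0 => /orP[]/eqP/norm2_eq0 ->.
    by rewrite norm20 mul0r /dot big1 // => i _; rewrite mxE mul0r.
  by rewrite norm20 mulr0 /dot big1 // => i _; rewrite mxE mulr0.
rewrite -subr_ge0 -(pmulr_rge0 _ p0).
have := dot_ge0 (norm2 v *: u - norm2 u *: v).
rewrite !dot_linear -!norm2_sqr (dotC v u) => h.
by lra.
Qed.

Lemma norm2D u v : norm2 (u + v) <= norm2 u + norm2 v.
Proof.
apply: norm2_le_sqr; first by rewrite addr_ge0 ?norm2_ge0.
by rewrite !dot_linear -!norm2_sqr (dotC v u); have := dot_le u v; nra.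
Qed.

Lemma norm2B u v : norm2 (u - v) <= norm2 u + norm2 v.
Proof. by rewrite -(norm2N v); exact: norm2D. Qed.

Lemma norm2_sum (I : finType) (F : I -> 'cV[R]_m) :
  norm2 (\sum_i F i) <= \sum_i norm2 (F i).
Proof.
elim/big_ind2: _ => [|x1 x2 y1 y2 h1 h2|//]; first by rewrite norm20.
by apply: le_trans (norm2D _ _) _; exact: lerD.
Qed.

Lemma norm2_delta (i : 'I_m) : norm2 (delta_mx i 0 : 'cV[R]_m) = 1.
Proof.
apply/eqP; rewrite -(@eqrXn2 _ 2) ?norm2_ge0 // norm2_sqr expr1n /dot.
rewrite (bigD1 i) //= mxE !eqxx mulr1 big1 ?addr0 // => j /negPf ji.
by rewrite mxE ji mul0r.
Qed.

Lemma normr_entry_le (u : 'cV[R]_m) i : `|u i 0| <= norm2 u.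
Proof.
rewrite -(@ler_pXn2r _ 2) ?nnegrE ?norm2_ge0 // real_normK ?num_real //.
rewrite norm2_sqr /dot (bigD1 i) //= -expr2 lerDl.
by apply: sumr_ge0 => j _; rewrite -expr2 sqr_ge0.
Qed.

End Euclidean.

(** * The spectral norm as a supremum over the unit ball *)

Section OperatorNorm.
Variable R : realType.

(** Entries of a vector in the unit ball are at most 1 in absolute value, so the sum of the column
    norms is an upper bound. Boundedness is what makes [sup] a true supremum. *)
Lemma mxnorm2_has_sup (m q : nat) (M : 'M[R]_(m, q)) :
  has_sup [set norm2 (M *m v) | v in [set v : 'cV[R]_q | norm2 v <= 1]].
Proof.
split; first by exists (norm2 (M *m 0)), 0 => //=; rewrite norm20.
exists (\sum_j norm2 (col j M)) => _ [v /= v1 <-].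
have -> : M *m v = \sum_j v j 0 *: col j M.
  apply/matrixP => i k; rewrite ord1 mxE summxE.
  by apply: eq_bigr => j _; rewrite !mxE mulrC.
apply: le_trans (norm2_sum _) _; apply: ler_sum => j _.
rewrite norm2Z ler_piMl ?norm2_ge0 //.
exact: le_trans (normr_entry_le _ _) v1.
Qed.

Lemma mxnorm2_ge0 (m q : nat) (M : 'M[R]_(m, q)) : 0 <= mxnorm2 M.
Proof.
apply: le_trans (norm2_ge0 (M *m 0)) _.
apply: (sup_upper_bound (mxnorm2_has_sup M)).
by exists 0 => //=; rewrite norm20.
Qed.

Lemma mxnorm2_ub (m q : nat) (M : 'M[R]_(m, q)) v :
  norm2 (M *m v) <= mxnorm2 M * norm2 v.
Proof.
have [->|/eqP v0] := eqVneq v 0; first by rewrite mulmx0 !norm20 mulr0.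
have vp : 0 < norm2 v.
  by rewrite lt_def norm2_ge0 andbT; apply/eqP => /norm2_eq0.
have vE : v = norm2 v *: ((norm2 v)^-1 *: v).
  by rewrite scalerA divff ?gt_eqF // scale1r.
rewrite {1}vE -scalemxAr norm2Z ger0_norm ?norm2_ge0 // mulrC ler_pM2r //.
apply: (sup_upper_bound (mxnorm2_has_sup M)).
exists ((norm2 v)^-1 *: v) => //=.
by rewrite norm2Z ger0_norm ?invr_ge0 ?norm2_ge0 // mulVf ?gt_eqF.
Qed.

Lemma mxnorm2_le (m q : nat) (M : 'M[R]_(m, q)) b : 0 <= b ->
  (forall v, norm2 (M *m v) <= b * norm2 v) -> mxnorm2 M <= b.
Proof.
move=> b0 h; apply: ge_sup; first by case: (mxnorm2_has_sup M).
move=> _ [v /= v1 <-]; apply: le_trans (h v) _.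
by rewrite ler_piMr.
Qed.

Lemma normr_mxentry_le (m q : nat) (M : 'M[R]_(m, q)) i j :
  `|M i j| <= mxnorm2 M.
Proof.
have -> : M i j = (M *m (delta_mx j 0 : 'cV_q)) i 0 by rewrite -colE mxE.
apply: le_trans (normr_entry_le _ _) _.
by apply: le_trans (mxnorm2_ub _ _) _; rewrite norm2_delta mulr1.
Qed.

End OperatorNorm.

(** * Gradient steps for smooth, strongly convex functions *)

Section Gradient.
Variables (R : realType) (m : nat).
Variables (F : 'cV[R]_m -> R) (g : 'cV[R]_m -> 'cV[R]_m) (l mu : R).
Hypothesis l_gt0 : 0 < l.
Hypothesis g_lip : forall x y, norm2 (g x - g y) <= l * norm2 (x - y).
Hypothesis F_convex : forall x y,
  F x + dot (g x) (y - x) + mu / 2 * norm2 (x - y) ^+ 2 <= F y.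

(** Adding the convexity inequalities at [(x, y)] and [(y, x)] cancels the values of [F]. *)
Lemma strong_monotone x y : mu * dot (x - y) (x - y) <= dot (g x - g y) (x - y).
Proof.
have := F_convex x y; have := F_convex y x.
rewrite !norm2_sqr !dot_linear !(dotC y x); lra.
Qed.

Lemma dot_lip x y e : dot (g x - g y) e <= l * norm2 (x - y) * norm2 e.
Proof.
apply: le_trans (dot_le _ _) _.
by rewrite ler_wpM2r ?norm2_ge0 ?g_lip.
Qed.

(** Strong monotonicity and the Lipschitz bound are compared at a unit vector and the origin; a unit
    vector exists only in positive dimension. *)
Lemma strong_le_smooth : (0 < m)%N -> mu <= l.
Proof.
case: m F g g_lip F_convex strong_monotone dot_lip => // m' _ g' _ _ sm dl _.
pose e : 'cV[R]_m'.+1 := delta_mx 0 0.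
have := le_trans (sm e 0) (dl e 0 (e - 0)).
by rewrite -norm2_sqr subr0 norm2_delta expr1n !mulr1.
Qed.

Hypothesis mu_gt0 : 0 < mu.
Hypothesis mu_le : mu <= l.

(* Applying the bound on both halves of [e] sends [C] to [l / 4 + C / 2], whose
   fixed point [l / 2] is the constant of the descent lemma. *)
Lemma descent_halving C :
  (forall x e, F (x + e) <= F x + dot (g x) e + C * dot e e) ->
  forall x e, F (x + e) <= F x + dot (g x) e + (l / 4 + C / 2) * dot e e.
Proof.
move=> h x e; have := h (x + 2^-1 *: e) (2^-1 *: e).
have -> : x + 2^-1 *: e + 2^-1 *: e = x + e.
  by apply/matrixP => i j; rewrite !mxE; lra.
have := h x (2^-1 *: e).
have := dot_lip (x + 2^-1 *: e) x (2^-1 *: e).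
rewrite [x + _]addrC addrK -mulrA -expr2 norm2_sqr [_ + x]addrC !dot_linear; lra.
Qed.

(** Convexity at [x + e] and the Lipschitz bound give the constant [l]; [k] halvings bring it down
    to [l / 2 + l / 2 * 2^-1 ^+ k], and [k] is arbitrary. *)
Lemma descent x e : F (x + e) <= F x + dot (g x) e + l / 2 * dot e e.
Proof.
have h k : forall x e,
    F (x + e) <= F x + dot (g x) e + (l / 2 + l / 2 * 2^-1 ^+ k) * dot e e.
  elim: k => [|k IH] {}x {}e.
    have := F_convex (x + e) x; have := dot_lip (x + e) x e.
    rewrite [x + e]addrC addrK opprD addrCA subrr addr0.
    have -> : dot (g (e + x)) (- e) = - dot (g (e + x)) e.
      by rewrite -scaleN1r dotZr mulN1r.
    rewrite -mulrA -expr2 !norm2_sqr !dot_linear expr0.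
    have := mulr_ge0 (ltW mu_gt0) (dot_ge0 e); lra.
  apply: le_trans (descent_halving IH x e) _.
  by rewrite lerD2l ler_wpM2r ?dot_ge0 // exprS; lra.
rewrite leNgt -subr_gt0; apply/negP => b0; set b := _ - _ in b0.
(* Were the claim to fail by [b > 0], this [k] would satisfy [l / 2 * dot e e / b < k < 2 ^+ k], so
   the excess allowed after [k] halvings would be below [b]. *)
pose k := (Num.truncn (l / 2 * dot e e / b)).+1.
have : l / 2 * dot e e < b * 2 ^+ k.
  rewrite [ltRHS]mulrC -ltr_pdivrMr //; apply: lt_trans (truncnS_gt _) _.
  by rewrite -natrX ltr_nat ltn_expl.
have : b <= l / 2 * dot e e * 2^-1 ^+ k by have := h k x e; rewrite /b; lra.
by rewrite exprVn ler_pdivlMr ?exprn_gt0 // leNgt => /negP.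
Qed.

(* The minimizer [y + (l - mu)^-1 h] of the upper model around [y] is compared with
   the lower model around [x]. *)
Lemma cocoercive_half x y : let h := g x - g y - mu *: (x - y) in mu < l ->
  F x - F y - dot (g x) (x - y) + mu / 2 * dot (x - y) (x - y)
    + (l - mu)^-1 / 2 * dot h h <= 0.
Proof.
move=> h; rewrite -subr_gt0 => L0.
have hE : h = g x - g y - mu *: (x - y) by [].
clearbody h.
have := F_convex x (y + (l - mu)^-1 *: h).
have := descent y ((l - mu)^-1 *: h).
have -> : l / 2 = mu / 2 + (l - mu) / 2 by lra.
set s := (l - mu)^-1; have sE : (l - mu) * s = 1 by rewrite divff ?gt_eqF.
have hh : dot h h = dot (g x) h - dot (g y) h - mu * (dot x h - dot y h).
  by rewrite {1}hE !dot_linear; ring.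
rewrite norm2_sqr !dot_linear !(dotC h) (dotC y x).
have -> : (mu / 2 + (l - mu) / 2) * (s * (s * dot h h)) =
    mu / 2 * (s * (s * dot h h)) + ((l - mu) * s) / 2 * s * dot h h by ring.
rewrite sE.
have : s * dot h h = s * dot (g x) h - s * dot (g y) h
    - mu * s * dot x h + mu * s * dot y h by rewrite hh; ring.
lra.
Qed.

(** The two instances of [cocoercive_half], at [(x, y)] and [(y, x)], are added so that the values
    of [F] cancel. *)
Lemma cocoercive x y :
  dot (g x - g y - mu *: (x - y)) (g x - g y - mu *: (x - y))
    <= (l - mu) * dot (g x - g y - mu *: (x - y)) (x - y).
Proof.
have lm : dot (g x - g y) (g x - g y) <= l ^+ 2 * dot (x - y) (x - y).
  rewrite -!norm2_sqr -exprMn ler_pXn2r ?nnegrE ?mulr_ge0 ?norm2_ge0 //.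
  exact: ltW.
have sm := strong_monotone x y.
(* When [mu = l] no division by [l - mu] is possible, but the Lipschitz bound and strong
   monotonicity then force the left-hand side to be at most 0. *)
have := mu_le; rewrite le_eqVlt => /predU1P[lE|L0].
  move: lm sm; rewrite -lE subrr mul0r; move: (x - y) (g x - g y) => e h lm sm.
  rewrite !dot_linear !(dotC e h).
  have := ler_wpM2l (ltW mu_gt0) sm; lra.
rewrite -ler_pdivrMl ?subr_gt0 //.
have := cocoercive_half x y L0; have := cocoercive_half y x L0 => /=.
rewrite -(opprB x y) -(opprB (g x) (g y)) scalerN -opprD.
rewrite -![- (_ : 'cV__)]scaleN1r !dot_linear; lra.
Qed.

(** With [E], [P], [G] the inner products below, co-coercivity reads
    [G + mu * l * E <= (mu + l) * P]. Eliminating [P] from [E - 2 a P + a^2 G] leaves an affine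
    function of [G], to be maximized over [mu ^+ 2 * E <= G <= l ^+ 2 * E]. *)
Lemma gradient_step a x y : 0 <= a ->
  norm2 (x - y - a *: (g x - g y))
    <= Num.max `|1 - a * mu| `|1 - a * l| * norm2 (x - y).
Proof.
move=> a0; apply: norm2_le_sqr.
  by rewrite mulr_ge0 ?norm2_ge0 // le_max normr_ge0.
have := cocoercive x y; have := strong_monotone x y.
have : dot (g x - g y) (g x - g y) <= l ^+ 2 * dot (x - y) (x - y).
  rewrite -!norm2_sqr -exprMn ler_pXn2r ?nnegrE ?mulr_ge0 ?norm2_ge0 //.
  exact: ltW.
have := dot_ge0 (g x - g y - mu *: (x - y)).
have := dot_ge0 (x - y).
rewrite exprMn norm2_sqr.
move: (x - y) (g x - g y) => e h; rewrite !dot_linear !(dotC e h).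
set E := dot e e; set P := dot h e; set G := dot h h => E0 G1 G2 P1 co.
have G3 : mu ^+ 2 * E <= G by have := ler_wpM2l (ltW mu_gt0) P1; lra.
have S0 : 0 < mu + l by rewrite addr_gt0.
(* The slope in [G] has the sign of [a * (mu + l) - 2], up to the factor [a >= 0]. The worst case is
   [G = mu ^+ 2 * E] here and [G = l ^+ 2 * E] in the other branch; they give the squares of
   [1 - a * mu] and [1 - a * l]. *)
have [aS|aS] := lerP (a * (mu + l)) 2.
  apply: (@le_trans _ _ (`|1 - a * mu| ^+ 2 * E)); last first.
    by rewrite ler_wpM2r // ler_pXn2r ?nnegrE // ?le_max ?normr_ge0 ?lexx.
  rewrite real_normK ?num_real // -(ler_pM2l S0).
  have : 0 <= a * (2 - a * (mu + l)) * (G - mu ^+ 2 * E).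
    by rewrite !mulr_ge0 // ?subr_ge0.
  have := ler_wpM2l a0 co.
  lra.
apply: (@le_trans _ _ (`|1 - a * l| ^+ 2 * E)); last first.
  rewrite ler_wpM2r // ler_pXn2r ?nnegrE // ?le_max ?normr_ge0 ?lexx ?orbT //.
rewrite real_normK ?num_real // -(ler_pM2l S0).
have : 0 <= a * (a * (mu + l) - 2) * (l ^+ 2 * E - G).
  by rewrite !mulr_ge0 // ?subr_ge0 // ltW.
have := ler_wpM2l a0 co.
lra.
Qed.

(** At [y = x - t *: g x], minimality and convexity give [dot (g y) (x - y) <= 0]. Since
    [l * t = 1 / 2], the Lipschitz bound then yields [t |g x|^2 <= t |g x|^2 / 2]. *)
Lemma minimizer_grad_eq0 x : (forall y, F x <= F y) -> g x = 0.
Proof.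
move=> xmin; apply/norm2_eq0/eqP; rewrite -sqrf_eq0 norm2_sqr eq_le dot_ge0 andbT.
pose t := (2 * l)^-1; have t0 : 0 < t by rewrite invr_gt0 mulr_gt0.
pose y := x - t *: g x.
have yx : x - y = t *: g x by rewrite opprB addrC subrK.
have : 0 <= - dot (g y) (x - y).
  have := F_convex y x; have := xmin y.
  have := mulr_ge0 (ltW mu_gt0) (dot_ge0 (y - x)); rewrite norm2_sqr; lra.
have := dot_lip x y (x - y).
rewrite -mulrA -expr2 norm2_sqr yx !dot_linear.
have -> : l * (t * (t * dot (g x) (g x))) = (l * t) * t * dot (g x) (g x) by ring.
have -> : l * t = 2^-1 by rewrite /t invfM mulrCA divff ?mulr1 ?gt_eqF.
move=> h1 h2; rewrite -(pmulr_rle0 _ t0); lra.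
Qed.
End Gradient.

(** * Block vectors and Kronecker products with the identity *)

Section Blocks.
Variables (R : realType) (n p : nat).
Implicit Types (x y : 'cV[R]_(n * p)) (M : 'M[R]_n) (w : 'rV[R]_n).

Lemma blk_inj x y : (forall i, blk x i = blk y i) -> x = y.
Proof.
move=> xy; apply/matrixP => k j; rewrite ord1 -(mxtens_unindexK k).
case: (mxtens_unindex k) => a b.
by have /matrixP/(_ b 0) := xy a; rewrite !mxE.
Qed.

Lemma blkB x y i : blk (x - y) i = blk x i - blk y i.
Proof. by apply/matrixP => a b; rewrite !mxE. Qed.

Lemma blkZ a x i : blk (a *: x) i = a *: blk x i.
Proof. by apply/matrixP => b e; rewrite !mxE. Qed.

Lemma blk_stack (v : 'I_n -> 'cV[R]_p) i : blk (stack v) i = v i.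
Proof. by apply/matrixP => a b; rewrite !mxE mxtens_indexK ord1. Qed.

Lemma blk_ones (u : 'cV[R]_p) i : blk ((const_mx 1 : 'cV_n) *t u) i = u.
Proof.
by apply/matrixP => a b; rewrite !mxE mxtens_indexK mul1r; congr (u _ _); rewrite !ord1.
Qed.

Lemma sum_blocks (F : 'I_(n * p) -> R) :
  \sum_k F k = \sum_i \sum_j F (mxtens_index (i, j)).
Proof.
rewrite pair_bigA (reindex (@mxtens_index n p)) //=.
  by apply: eq_bigr => -[].
by exists (@mxtens_unindex n p) => k _; [exact: mxtens_indexK | exact: mxtens_unindexK].
Qed.

Lemma dot_blk x y : dot x y = \sum_i dot (blk x i) (blk y i).
Proof.
by rewrite /dot sum_blocks; do 2!apply: eq_bigr => ? _; rewrite !mxE.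
Qed.

Lemma blk_kronI M x i : blk (kronI p M *m x) i = \sum_j M i j *: blk x j.
Proof.
apply/matrixP => a b; rewrite !mxE summxE sum_blocks.
apply: eq_bigr => j _; rewrite (bigD1 a) //= big1 ?addr0 => [|a' a'a].
  by rewrite tensmxE !mxE eqxx mulr1.
by rewrite tensmxE mxE eq_sym (negPf a'a) mulr0 mul0r.
Qed.

Lemma blk_kronI_diag w x i : blk (kronI p (diag_mx w) *m x) i = w 0 i *: blk x i.
Proof.
rewrite blk_kronI (bigD1 i) //= big1 ?addr0 => [|j ji].
  by rewrite mxE eqxx mulr1n.
by rewrite mxE eq_sym (negPf ji) mulr0n scale0r.
Qed.

Lemma kronI_mul M1 M2 : kronI p (M1 *m M2) = kronI p M1 *m kronI p M2.
Proof. by rewrite /kronI tensmx_mul mulmx1. Qed.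

Lemma kronI1 : kronI p (1%:M : 'M[R]_n) = 1%:M.
Proof.
apply/matrixP => i j; rewrite -(mxtens_unindexK i) -(mxtens_unindexK j) tensmxE !mxE.
rewrite (can_eq (@mxtens_indexK n p)) -mulnb.
by rewrite natrM.
Qed.

Lemma kronIB M1 M2 : kronI p (M1 - M2) = kronI p M1 - kronI p M2.
Proof. by apply/matrixP => i j; rewrite !mxE mulrBl. Qed.

Lemma norm2_kronI_diag w b x : 0 <= b -> (forall i, `|w 0 i| <= b) ->
  norm2 (kronI p (diag_mx w) *m x) <= b * norm2 x.
Proof.
move=> b0 wb; apply: norm2_le_sqr; first by rewrite mulr_ge0 ?norm2_ge0.
rewrite exprMn norm2_sqr !dot_blk mulr_sumr; apply: ler_sum => i _.
rewrite blk_kronI_diag !dot_linear mulrA -expr2 ler_wpM2r ?dot_ge0 //.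
by rewrite -real_normK ?num_real // ler_pXn2r ?nnegrE.
Qed.

Lemma normr_le_mxnorm2_kronI M i j : (0 < p)%N -> `|M i j| <= mxnorm2 (kronI p M).
Proof.
move=> p0; pose a := Ordinal p0.
have := normr_mxentry_le (kronI p M) (mxtens_index (i, a)) (mxtens_index (j, a)).
by rewrite tensmxE !mxE eqxx mulr1.
Qed.

(** Cauchy-Schwarz against the all-ones vector. *)
Lemma sqr_sum_le (F : 'I_n -> R) : (forall i, 0 <= F i) ->
  (\sum_i F i) ^+ 2 <= n%:R * \sum_i F i ^+ 2.
Proof.
move=> F0; pose u : 'cV[R]_n := \col_i F i; pose o : 'cV[R]_n := const_mx 1.
have uo : dot u o = \sum_i F i by apply: eq_bigr => i _; rewrite !mxE mulr1.
have oE : dot o o = n%:R.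
  rewrite /dot (eq_bigr (fun=> 1)) => [|i _]; last by rewrite mxE mulr1.
  by rewrite sumr_const card_ord.
have uu : dot u u = \sum_i F i ^+ 2 by apply: eq_bigr => i _; rewrite !mxE expr2.
rewrite -uo -oE -uu -!norm2_sqr -exprMn mulrC.
by rewrite ler_pXn2r ?nnegrE ?mulr_ge0 ?norm2_ge0 ?dot_le // uo sumr_ge0.
Qed.

(** Each of the [n] blocks of the image is the sum of all blocks of [x]: the repetition contributes
    one factor [n] to the square, [sqr_sum_le] the other. *)
Lemma norm2_kronI_ones x :
  norm2 (kronI p (const_mx 1 : 'M[R]_n) *m x) <= n%:R * norm2 x.
Proof.
have bE i : blk (kronI p (const_mx 1 : 'M[R]_n) *m x) i = \sum_j blk x j.
  by rewrite blk_kronI; apply: eq_bigr => j _; rewrite mxE scale1r.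
apply: norm2_le_sqr; first by rewrite mulr_ge0 ?norm2_ge0.
rewrite exprMn norm2_sqr !dot_blk expr2 -mulrA.
rewrite (eq_bigr (fun=> dot (\sum_j blk x j) (\sum_j blk x j))) => [|i _];
  last by rewrite bE.
rewrite sumr_const card_ord -[leLHS]mulr_natl ler_wpM2l //.
rewrite -norm2_sqr; apply: (@le_trans _ _ ((\sum_j norm2 (blk x j)) ^+ 2)).
  rewrite ler_pXn2r ?nnegrE ?norm2_ge0 ?norm2_sum ?sumr_ge0 // => i _.
  exact: norm2_ge0.
apply: le_trans (sqr_sum_le _) _ => [i|]; first exact: norm2_ge0.
by rewrite ler_wpM2l // ler_sum // => i _; rewrite norm2_sqr.
Qed.

Lemma norm2_const_blk x (u : 'cV[R]_p) : (forall i, blk x i = u) ->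
  norm2 x = Num.sqrt n%:R * norm2 u.
Proof.
move=> xu; apply/eqP; rewrite -(@eqrXn2 _ 2) ?mulr_ge0 ?norm2_ge0 ?sqrtr_ge0 //.
rewrite exprMn !norm2_sqr sqr_sqrtr ?ler0n // dot_blk.
rewrite (eq_bigr (fun=> dot u u)) => [|i _]; last by rewrite xu.
by rewrite sumr_const card_ord mulr_natl.
Qed.

Lemma gradf_lip (f : 'I_n -> 'cV[R]_p -> R) (l : R) x y : 0 <= l ->
  (forall i u v, norm2 (grad (f i) u - grad (f i) v) <= l * norm2 (u - v)) ->
  norm2 (gradf f x - gradf f y) <= l * norm2 (x - y).
Proof.
move=> l0 fl; apply: norm2_le_sqr; first by rewrite mulr_ge0 ?norm2_ge0.
rewrite exprMn norm2_sqr !dot_blk mulr_sumr; apply: ler_sum => i _.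
rewrite !blkB !blk_stack -!norm2_sqr -exprMn.
by rewrite ler_pXn2r ?nnegrE ?mulr_ge0 ?norm2_ge0.
Qed.

End Blocks.

(** * Powers of the weight matrix, their limit and their diagonal parts *)

Section Weights.
Variables (R : realType) (n p : nat) (Au : 'M[R]_n) (pi : 'cV[R]_n) (r sigma : R).
Hypothesis p_gt0 : (0 < p)%N.
Hypothesis Au_ge0 : forall i j, 0 <= Au i j.
Hypothesis Au_diag_gt0 : forall i, 0 < Au i i.
Hypothesis Au_stoch : forall i, \sum_j Au i j = 1.
Hypothesis pi_gt0 : forall i, 0 < pi i 0.
Hypothesis pi_left : pi^T *m Au = pi^T.
Hypothesis pi_sum : pi^T *m (const_mx 1 : 'cV[R]_n) = 1%:M.
Hypotheses (sigma_gt0 : 0 < sigma) (sigma_lt1 : sigma < 1) (r_gt0 : 0 < r).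
Hypothesis Y_rate : forall k, mxnorm2 (Ymx p Au k - Yinf p pi) <= r * sigma ^+ k.

Let y := sup [set mxnorm2 (Ymx p Au k) | k in [set: nat]].
Let yt := sup [set mxnorm2 (invmx (Yt p Au k)) | k in [set: nat]].

Lemma sum_pi : \sum_i pi i 0 = 1.
Proof.
have /matrixP/(_ 0 0) := pi_sum; rewrite !mxE eqxx mulr1n => <-.
by apply: eq_bigr => i _; rewrite !mxE mulr1.
Qed.

Lemma blk_Yinf x i : blk (Yinf p pi *m x) i = \sum_j pi j 0 *: blk x j.
Proof.
rewrite blk_kronI; apply: eq_bigr => j _.
by rewrite mxE big_ord1 !mxE mul1r.
Qed.

Lemma Yinf_mulA : Yinf p pi *m kronI p Au = Yinf p pi.
Proof. by rewrite -kronI_mul -mulmxA pi_left. Qed.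

Lemma mulA_Yinf : kronI p Au *m Yinf p pi = Yinf p pi.
Proof.
rewrite -kronI_mul mulmxA; congr (kronI p (_ *m _)).
apply/matrixP => i j; rewrite !mxE; apply: etrans (Au_stoch i).
by apply: eq_bigr => k _; rewrite mxE mulr1.
Qed.

Lemma YtE k : Yt p Au k = kronI p (diag_mx (\row_i Yu Au k i i)).
Proof.
apply/matrixP => i j; rewrite -(mxtens_unindexK i) -(mxtens_unindexK j).
case: (mxtens_unindex i) (mxtens_unindex j) => a b [a' b'].
rewrite tensmxE !mxE !mxtens_indexK /= (can_eq (@mxtens_indexK n p)) xpair_eqE.
rewrite eqxx mulr1; case: eqP => [->|_] /=; last by rewrite !mulr0n mul0r.
by case: eqP => _; rewrite ?mulr1n ?mulr0n ?mulr1 ?mulr0.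
Qed.

Lemma Yu_ge0 k i j : 0 <= Yu Au k i j.
Proof.
elim: k i j => [|k IH] i j /=; first by rewrite mxE; case: eqP.
by rewrite mxE sumr_ge0 // => h _; rewrite mulr_ge0.
Qed.

(** The self-loop contributes [Au i i * Yu Au k i i > 0] to the next diagonal entry and all other
    terms are nonnegative. This makes every [Yt] invertible. *)
Lemma Yu_diag_gt0 k i : 0 < Yu Au k i i.
Proof.
elim: k => [|k IH] /=; first by rewrite mxE eqxx.
rewrite mxE (bigD1 i) //= ltr_wpDr ?mulr_gt0 ?sumr_ge0 // => j _.
by rewrite mulr_ge0 ?Yu_ge0.
Qed.

Lemma invmx_Yt k : invmx (Yt p Au k) = kronI p (diag_mx (\row_i (Yu Au k i i)^-1)).
Proof.
set B := RHS; have YB : Yt p Au k *m B = 1%:M.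
  rewrite YtE -kronI_mul mulmx_diag -kronI1; congr (kronI p _).
  rewrite -diag_const_mx; congr diag_mx; apply/matrixP => i j.
  by rewrite !mxE divff // gt_eqF ?Yu_diag_gt0.
have [Yu_ _] := mulmx1_unit YB.
by rewrite -[LHS]mulmx1 -YB mulKmx.
Qed.

Lemma Yu_diag_rate k i : `|Yu Au k i i - pi i 0| <= r * sigma ^+ k.
Proof.
apply: le_trans (Y_rate k); rewrite -kronIB.
apply: le_trans (normr_le_mxnorm2_kronI _ i i p_gt0).
by rewrite !mxE big_ord1 !mxE mul1r.
Qed.

Lemma rate_cvg0 : (r * sigma ^+ k)%R @[k --> \oo] --> (0 : R).
Proof.
by apply: cvg_geometric; rewrite ger0_norm // ltW.
Qed.

Lemma Yu_diag_cvg i : Yu Au k i i @[k --> \oo] --> pi i 0.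
Proof.
apply/cvgrPdist_le => e e0.
near=> k; rewrite distrC; apply: le_trans (Yu_diag_rate k i) _.
apply: le_trans (ler_norm _) _; near: k.
by apply: (cvgr0_norm_le _ rate_cvg0).
Unshelve. all: by end_near. Qed.

Lemma Yu_diagV_cvg i : (Yu Au k i i)^-1 @[k --> \oo] --> (pi i 0)^-1.
Proof. by apply: cvgV; [rewrite gt_eqF | exact: Yu_diag_cvg]. Qed.

(** The set under the supremum is bounded, because [r * sigma ^+ k <= r] keeps all powers within
    distance [r] of [Yinf]. *)
Lemma mxnorm2_Ymx_le k : mxnorm2 (Ymx p Au k) <= y.
Proof.
apply: ub_le_sup; last by exists k.
exists (mxnorm2 (Yinf p pi) + r) => _ [j _ <-].
apply: mxnorm2_le => [|v]; first by rewrite addr_ge0 ?mxnorm2_ge0 ?ltW.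
rewrite -[Ymx p Au j](subrK (Yinf p pi)) mulmxDl mulrDl addrC.
apply: le_trans (norm2D _ _) _; apply: lerD; first exact: mxnorm2_ub.
apply: le_trans (mxnorm2_ub _ _) _; rewrite ler_wpM2r ?norm2_ge0 //.
apply: le_trans (Y_rate _) _; rewrite ger_pMr // exprn_ile1 //; exact: ltW.
Qed.

(** Each inverse diagonal entry converges, as its limit [(pi i 0)^-1] is that of a positive number,
    hence is bounded in [k]; the sum of these finitely many bounds serves for the whole diagonal
    matrix. *)
Lemma mxnorm2_Yt_le k : mxnorm2 (invmx (Yt p Au k)) <= yt.
Proof.
apply: ub_le_sup; last by exists k.
have /choice[B HB] i : exists b, forall k, `|(Yu Au k i i)^-1| <= b.
  have [M [_ HM]] := cvg_seq_bounded (cvgP _ (@Yu_diagV_cvg i)).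
  (* Boundedness is stated as: every real above [M] is a bound. *)
  by exists (M + 1) => j; apply: HM => //; rewrite ltrDl.
exists (\sum_i B i) => _ [j _ <-].
have B0 i : 0 <= B i by apply: le_trans (HB i 0).
apply: mxnorm2_le => [|v]; first exact: sumr_ge0.
rewrite invmx_Yt; apply: norm2_kronI_diag => [|i]; first exact: sumr_ge0.
by rewrite mxE (bigD1 i) //= ler_wpDr ?HB // sumr_ge0.
Qed.

Lemma Yu_diagV_le k i : (Yu Au k i i)^-1 <= yt.
Proof.
apply: le_trans (mxnorm2_Yt_le k); rewrite invmx_Yt.
apply: le_trans (normr_le_mxnorm2_kronI _ i i p_gt0).
by rewrite !mxE eqxx mulr1n ler_norm.
Qed.

Lemma piV_le i : (pi i 0)^-1 <= yt.
Proof.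
rewrite -(cvg_lim _ (Yu_diagV_cvg (i := i))) //.
apply: limr_le; first exact: cvgP (@Yu_diagV_cvg i).
by near=> k; exact: Yu_diagV_le.
Unshelve. all: by end_near. Qed.

(** [Yinf] lies within [r * sigma ^+ k] of a matrix of norm at most [y], and that distance is
    arbitrarily small. *)
Lemma mxnorm2_Yinf_le : mxnorm2 (Yinf p pi) <= y.
Proof.
apply/ler_addgt0Pr => e e0.
have [k hk] : exists k, r * sigma ^+ k <= e.
  have := cvgr0_norm_le _ rate_cvg0 _ e0; case=> k _ /(_ k (leqnn k)) /= hk.
  by exists k; apply: le_trans hk; exact: ler_norm.
have y0 : 0 <= y by apply: le_trans (mxnorm2_Ymx_le 0); exact: mxnorm2_ge0.
apply: mxnorm2_le => [|v]; first by rewrite addr_ge0 // ltW.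
rewrite -[Yinf p pi](subKr (Ymx p Au k)) mulmxBl mulrDl.
apply: le_trans (norm2B _ _) _; apply: lerD.
  by apply: le_trans (mxnorm2_ub _ _) _; rewrite ler_wpM2r ?norm2_ge0 ?mxnorm2_Ymx_le.
apply: le_trans (mxnorm2_ub _ _) _; rewrite ler_wpM2r ?norm2_ge0 //.
exact: le_trans hk.
Qed.

(** Weighting block [j] by [(pi j 0)^-1] and then averaging with [pi] gives the plain sum of the
    blocks. What remains is [Yinf] applied to a difference of inverse weights, where
    [1/a - 1/b = -(a - b)/(a b)] brings in the rate and [yt ^+ 2]. *)
Lemma Yinf_invYt_err k v :
  norm2 (Yinf p pi *m (invmx (Yt p Au k) *m v) - kronI p (const_mx 1) *m v)
    <= r * y * yt ^+ 2 * sigma ^+ k * norm2 v.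
Proof.
have -> : kronI p (const_mx 1) *m v =
    Yinf p pi *m (kronI p (diag_mx (\row_i (pi i 0)^-1)) *m v).
  apply: blk_inj => i; rewrite blk_Yinf blk_kronI; apply: eq_bigr => j _.
  by rewrite blk_kronI_diag !mxE scalerA divff ?gt_eqF.
rewrite -mulmxBr -mulmxBl invmx_Yt -kronIB -linearB /=.
have y0 : 0 <= y by apply: le_trans mxnorm2_Yinf_le; exact: mxnorm2_ge0.
apply: le_trans (mxnorm2_ub _ _) _.
have -> : r * y * yt ^+ 2 * sigma ^+ k * norm2 v =
  y * ((r * sigma ^+ k * yt ^+ 2) * norm2 v) by ring.
apply: ler_pM; rewrite ?mxnorm2_ge0 ?norm2_ge0 ?mxnorm2_Yinf_le //.
have rs0 : 0 <= r * sigma ^+ k * yt ^+ 2.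
  by rewrite mulr_ge0 ?sqr_ge0 // mulr_ge0 ?exprn_ge0 ?ltW.
apply: norm2_kronI_diag => // i; rewrite !mxE.
have u0 := Yu_diag_gt0 k i; have p0 := pi_gt0 i.
have -> : (Yu Au k i i)^-1 - (pi i 0)^-1 =
    - ((Yu Au k i i - pi i 0) * ((Yu Au k i i)^-1 * (pi i 0)^-1)).
  by field; rewrite !gt_eqF.
rewrite normrN normrM ler_pM ?Yu_diag_rate //.
by rewrite ger0_norm ?expr2 ?ler_pM ?mulr_ge0 ?invr_ge0 ?Yu_diagV_le ?piV_le // ltW.
Qed.

(** The same identity for inverses, with the two diagonals compared through their common limit
    [pi]. *)
Lemma invYt_diff j k v :
  norm2 (invmx (Yt p Au j) *m v - invmx (Yt p Au k) *m v)
    <= (r * sigma ^+ j + r * sigma ^+ k) * yt ^+ 2 * norm2 v.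
Proof.
have rs0 m : 0 <= r * sigma ^+ m by rewrite mulr_ge0 ?exprn_ge0 // ltW.
rewrite -mulmxBl !invmx_Yt -kronIB -linearB.
apply: norm2_kronI_diag => [|i]; first by rewrite mulr_ge0 ?sqr_ge0 // addr_ge0.
rewrite !mxE; have uj := Yu_diag_gt0 j i; have uk := Yu_diag_gt0 k i.
have -> : (Yu Au j i i)^-1 - (Yu Au k i i)^-1 =
    ((Yu Au k i i - pi i 0) - (Yu Au j i i - pi i 0))
      * ((Yu Au j i i)^-1 * (Yu Au k i i)^-1).
  by field; rewrite !gt_eqF.
rewrite normrM ler_pM //; last first.
  by rewrite ger0_norm ?expr2 ?ler_pM ?mulr_ge0 ?invr_ge0 ?Yu_diagV_le // ltW.
by apply: le_trans (ler_normB _ _) _; rewrite addrC lerD ?Yu_diag_rate.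
Qed.

End Weights.

(** * A spectral radius bound for nonnegative matrices *)

Lemma normc_ge0 (R : realType) (z : complex R) : 0 <= Normc.normc z.
Proof. by case: z => a b; exact: sqrtr_ge0. Qed.

Lemma normc_real (R : realType) (a : R) : Normc.normc (real_complex R a) = `|a|.
Proof. by rewrite /= expr0n addr0 sqrtr_sqr. Qed.

Lemma normc_sum (R : realType) (I : finType) (F : I -> complex R) :
  Normc.normc (\sum_i F i) <= \sum_i Normc.normc (F i).
Proof.
elim/big_ind2: _ => [|x1 x2 y1 y2 h1 h2|i _]; [by rewrite Normc.normc0| |by []].
by apply: le_trans (le_normcD _ _) _; exact: lerD.
Qed.

(* For a left eigenvector [v] with eigenvalue [z], the triangle inequality gives
   [|z| |v| <= |v| M] entrywise, and pairing with [w] bounds [|z|]. *)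
Lemma spectral_radius_lt1 (R : realType) (m : nat) (M : 'M[R]_m) (w : 'cV[R]_m) :
  (forall i j, 0 <= M i j) -> (forall i, 0 < w i 0) ->
  (forall i, (M *m w) i 0 < w i 0) -> spectral_radius M < 1.
Proof.
move=> M0 w0 Mw.
rewrite /spectral_radius; set S := [set _ | _ in _].
(* The Collatz-Wielandt ratio of [w]. The default 0 keeps [rho] nonnegative, which settles the case
   of an empty spectrum, where [sup] is 0. *)
pose rho := \big[Num.max/0]_i ((M *m w) i 0 / w i 0).
have rho_lt1 : rho < 1 by apply: bigmax_lt => // i _; rewrite ltr_pdivrMr ?mul1r.
apply: le_lt_trans rho_lt1.
have rho0 : 0 <= rho by exact: bigmax_ge_id.
have ubS : ubound S rho.
  move=> _ [z /eigenvalueP[v vM v0] <-].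
  pose c j := Normc.normc (v 0 j).
  have c0 j : 0 <= c j by exact: normc_ge0.
  have zc j : Normc.normc z * c j <= \sum_i c i * M i j.
    have /matrixP/(_ 0 j) := vM; rewrite !mxE => vMj.
    rewrite /c -Normc.normcM -vMj; apply: le_trans (normc_sum _) _.
    by apply: ler_sum => i _; rewrite Normc.normcM mxE normc_real ger0_norm.
  (* The eigenvector has a nonzero entry, so its pairing with the positive [w] can be cancelled
     below. *)
  have cw0 : 0 < \sum_j c j * w j 0.
    have /existsP[j vj] : [exists j, v 0 j != 0].
      apply: contraNT v0; rewrite negb_exists => /forallP v0.
      apply/eqP/matrixP => i j; rewrite ord1 mxE.
      by have := v0 j; rewrite negbK => /eqP.
    rewrite (bigD1 j) //=; apply: ltr_wpDr.
      by apply: sumr_ge0 => i _; rewrite mulr_ge0 // ltW.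
    rewrite mulr_gt0 // lt_def c0 andbT.
    by apply: contraNneq vj => /Normc.eq0_normc ->.
  rewrite -(ler_pM2r cw0) mulr_sumr.
  apply: (@le_trans _ _ (\sum_j (\sum_i c i * M i j) * w j 0)).
    by apply: ler_sum => j _; rewrite mulrA ler_wpM2r // ltW.
  under eq_bigr do rewrite mulr_suml.
  rewrite exchange_big mulr_sumr /=; apply: ler_sum => i _.
  under eq_bigr do rewrite -mulrA.
  rewrite -mulr_sumr mulrCA ler_wpM2l //.
  have : (M *m w) i 0 / w i 0 <= rho by exact: le_bigmax.
  by rewrite ler_pdivrMr // mxE.
have [->|/set0P S0] := eqVneq S set0; first by rewrite sup0.
exact: ge_sup.
Qed.

(** * Computation with three-dimensional columns and matrices *)

Lemma col3D (R : realType) (a b c a' b' c' : R) :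
  col3 a b c + col3 a' b' c' = col3 (a + a') (b + b') (c + c').
Proof. by apply/matrixP => -[[|[|[|]]] //= ?] j; rewrite !mxE. Qed.

Lemma col3Z (R : realType) (t a b c : R) :
  t *: col3 a b c = col3 (t * a) (t * b) (t * c).
Proof. by apply/matrixP => -[[|[|[|]]] //= ?] j; rewrite !mxE. Qed.

Lemma col3_le (R : realType) (a0 a1 a2 b0 b1 b2 : R) :
  a0 <= b0 -> a1 <= b1 -> a2 <= b2 ->
  forall i, col3 a0 a1 a2 i 0 <= col3 b0 b1 b2 i 0.
Proof. by move=> ? ? ? [[|[|[|]]] //= ?]; rewrite !mxE. Qed.

Lemma mx33_mul (R : realType) (a00 a01 a02 a10 a11 a12 a20 a21 a22 u0 u1 u2 : R) :
  mx33 (col3 a00 a01 a02) (col3 a10 a11 a12) (col3 a20 a21 a22) *m col3 u0 u1 u2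
  = col3 (a00 * u0 + a01 * u1 + a02 * u2) (a10 * u0 + a11 * u1 + a12 * u2)
         (a20 * u0 + a21 * u1 + a22 * u2).
Proof.
apply/matrixP => -[[|[|[|]]] //= ?] j;
  by rewrite !mxE !big_ord_recr big_ord0 /= !mxE /= add0r.
Qed.

(** * Smoothness and strong convexity of the average objective *)

Lemma dot_sum (R : realType) (n p : nat) (v : 'cV[R]_p) (F : 'I_n -> 'cV[R]_p) :
  dot (\sum_i F i) v = \sum_i dot (F i) v.
Proof.
elim/big_ind2: _ => [|a b a' b' <- <-|//]; last exact: dotDl.
by rewrite /dot big1 // => i _; rewrite mxE mul0r.
Qed.

Section AverageObjective.
Variables (R : realType) (n p : nat) (f : 'I_n -> 'cV[R]_p -> R) (l mu : R).
Hypothesis n_gt0 : (0 < n)%N.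
Hypothesis f_smooth : forall i x y,
  norm2 (grad (f i) x - grad (f i) y) <= l * norm2 (x - y).
Hypothesis f_convex : forall i x y,
  f i y >= f i x + ((grad (f i) x)^T *m (y - x)) 0 0 + mu / 2 * norm2 (x - y) ^+ 2.

(* Defined from the gradients of the summands, so that no differentiation rule
   is needed. *)
Definition avg_grad (u : 'cV[R]_p) : 'cV[R]_p := n%:R^-1 *: \sum_i grad (f i) u.

Lemma sum_grad u : \sum_i grad (f i) u = n%:R *: avg_grad u.
Proof. by rewrite scalerA divff ?scale1r // pnatr_eq0 -lt0n. Qed.

Lemma avg_grad_lip u v : norm2 (avg_grad u - avg_grad v) <= l * norm2 (u - v).
Proof.
rewrite -scalerBr -sumrB norm2Z ger0_norm ?invr_ge0 // ler_pdivrMl ?ltr0n //.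
apply: le_trans (norm2_sum _) _.
apply: (@le_trans _ _ (\sum_(i < n) l * norm2 (u - v))).
  by apply: ler_sum => i _; exact: f_smooth.
by rewrite sumr_const card_ord mulr_natl.
Qed.

Lemma avg_obj_convex u v :
  avg_obj f u + dot (avg_grad u) (v - u) + mu / 2 * norm2 (u - v) ^+ 2 <= avg_obj f v.
Proof.
rewrite /avg_obj /avg_grad dotZl dot_sum -mulrDr -big_split /=.
rewrite -(ler_pM2l (_ : 0 < n%:R)) ?ltr0n // mulrDr !mulrA divff ?pnatr_eq0 -?lt0n //.
rewrite !mul1r -!mulrA mulr_natl -[X in _ *+ X]card_ord -sumr_const -big_split /=.
by apply: ler_sum => i _; have := f_convex i u v; rewrite dotE mulrA.
Qed.

End AverageObjective.

(** * The FROST iterates: gradient tracking and error recursions *)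

Section Frost.
Variables (R : realType) (n p : nat) (f : 'I_n -> 'cV[R]_p -> R) (l mu : R).
Hypothesis p_gt0 : (0 < p)%N.
Hypotheses (l_gt0 : 0 < l) (mu_gt0 : 0 < mu).
Hypothesis f_smooth : forall i x y,
  norm2 (grad (f i) x - grad (f i) y) <= l * norm2 (x - y).
Hypothesis f_convex : forall i x y,
  f i y >= f i x + ((grad (f i) x)^T *m (y - x)) 0 0 + mu / 2 * norm2 (x - y) ^+ 2.
Variable xstar : 'cV[R]_p.
Hypothesis xstar_min : forall x, avg_obj f xstar <= avg_obj f x.
Variables (Au : 'M[R]_n) (pi : 'cV[R]_n) (r sigma : R).
Hypothesis Au_ge0 : forall i j, 0 <= Au i j.
Hypothesis Au_diag_gt0 : forall i, 0 < Au i i.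
Hypothesis Au_stoch : forall i, \sum_j Au i j = 1.
Hypothesis pi_gt0 : forall i, 0 < pi i 0.
Hypothesis pi_left : pi^T *m Au = pi^T.
Hypothesis pi_sum : pi^T *m (const_mx 1 : 'cV[R]_n) = 1%:M.
Hypotheses (sigma_gt0 : 0 < sigma) (sigma_lt1 : sigma < 1) (r_gt0 : 0 < r).
Hypothesis Y_rate : forall k, mxnorm2 (Ymx p Au k - Yinf p pi) <= r * sigma ^+ k.
Variables (alpha : 'cV[R]_n) (x0 : 'cV[R]_(n * p)).
Hypothesis alpha_ge0 : forall i, 0 <= alpha i 0.
Variables (N : 'cV[R]_(n * p) -> R) (c d : R).
Hypothesis N_norm : is_vector_norm N.
Hypothesis N_contr : forall a, N (kronI p Au *m a - Yinf p pi *m a)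
  <= sigma * N (a - Yinf p pi *m a).
Hypotheses (c_gt0 : 0 < c) (d_gt0 : 0 < d).
Hypothesis norm2_le : forall v, norm2 v <= c * N v.
Hypothesis N_le : forall v, N v <= d * norm2 v.

Let nR : R := n%:R.
Let A := kronI p Au.
Let D := kronI p (diag_mx alpha^T).
Let Yoo := Yinf p pi.
Let E := kronI p (const_mx 1 : 'M[R]_n).
Let tau := mxnorm2 (A - 1%:M).
Let eps := mxnorm2 (1%:M - Yoo).
Let y := sup [set mxnorm2 (Ymx p Au k) | k in [set: nat]].
Let yt := sup [set mxnorm2 (invmx (Yt p Au k)) | k in [set: nat]].
Let abar := max_entry alpha.
Let pia := (pi^T *m alpha) 0 0.
Let lambda := Num.max `|1 - nR * pia * mu| `|1 - nR * pia * l|.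
Let xs : 'cV[R]_(n * p) := (const_mx 1 : 'cV[R]_n) *t xstar.
Let x := frost_x Au f alpha x0.
Let z := frost_z Au f alpha x0.
Let W k := invmx (Yt p Au k).
Let Nx k := N (x k - Yoo *m x k).
Let Nv k := norm2 (Yoo *m x k - xs).
Let Nz k := N (z k - Yoo *m z k).
Let err k := Num.sqrt nR * r * y * yt ^+ 2 * sigma ^+ k * norm2 (gradf f (x k)).

(** An empty sum cannot equal 1, the total mass of [pi]. *)
Lemma dim_gt0 : (0 < n)%N.
Proof.
case: n pi pi_sum => // pi' /(@sum_pi _ _ _); rewrite big_ord0 => /eqP.
by rewrite eq_sym oner_eq0.
Qed.

Lemma pia_sum : pia = \sum_i pi i 0 * alpha i 0.
Proof. by rewrite /pia mxE; apply: eq_bigr => i _; rewrite mxE. Qed.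

Lemma alpha_le i : alpha i 0 <= abar.
Proof. exact: (le_bigmax _ (fun i => alpha i 0)). Qed.

Lemma abar_ge0 : 0 <= abar.
Proof. exact: bigmax_ge_id. Qed.

Lemma pia_ge0 : 0 <= pia.
Proof.
by rewrite pia_sum sumr_ge0 // => i _; rewrite mulr_ge0 // ltW.
Qed.

Lemma pia_le : pia <= abar.
Proof.
rewrite pia_sum -[abar]mul1r -(sum_pi pi_sum) mulr_suml.
by apply: ler_sum => i _; rewrite ler_pM2l // alpha_le.
Qed.

Lemma y_ge0 : 0 <= y.
Proof.
by apply: le_trans (mxnorm2_ge0 (Ymx p Au 0)) _; exact: mxnorm2_Ymx_le Y_rate _.
Qed.

Lemma yt_ge0 : 0 <= yt.
Proof.
apply: le_trans (mxnorm2_ge0 (invmx (Yt p Au 0))) _.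
by apply: mxnorm2_Yt_le Y_rate _.
Qed.

Lemma N_triangle u v : N (u + v) <= N u + N v.
Proof. by case: N_norm. Qed.

Lemma N_disp v : N ((1%:M - Yoo) *m v) <= d * (eps * norm2 v).
Proof. by apply: le_trans (N_le _) _; rewrite ler_pM2l // mxnorm2_ub. Qed.

Lemma N_opp v : N (- v) = N v.
Proof. by case: N_norm => _ _ NZ _; rewrite -scaleN1r NZ normrN1 mul1r. Qed.

Lemma x_next k : x k.+1 = A *m x k - D *m z k.
Proof. by rewrite /x /z /frost_x /frost_z /=; case: (frost _ _ _ _ k). Qed.

Lemma z_next k :
  z k.+1 = A *m z k + W k.+1 *m gradf f (x k.+1) - W k *m gradf f (x k).
Proof. by rewrite /x /z /frost_x /frost_z /=; case: (frost _ _ _ _ k). Qed.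

Lemma norm2_D v : norm2 (D *m v) <= abar * norm2 v.
Proof.
apply: norm2_kronI_diag => [|i]; first exact: abar_ge0.
by rewrite mxE ger0_norm // alpha_le.
Qed.

(** Gradient tracking: since [Yoo *m A = Yoo], the averaged increments telescope. At [k = 0] the
    matrix [W 0] is the identity. *)
Lemma Yinf_z k : Yoo *m z k = Yoo *m (W k *m gradf f (x k)).
Proof.
elim: k => [|k IH].
  rewrite /W (invmx_Yt p Au_ge0 Au_diag_gt0); congr (_ *m _); apply: blk_inj => i.
  by rewrite blk_kronI_diag !mxE eqxx invr1 scale1r.
rewrite z_next mulmxBr mulmxDr mulmxA Yinf_mulA // IH.
by rewrite addrAC subrr add0r.
Qed.

Lemma avg_grad_xstar : avg_grad f xstar = 0.
Proof.
apply: (minimizer_grad_eq0 l_gt0 _ _ mu_gt0 xstar_min).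
  by apply: avg_grad_lip f_smooth => //; exact: dim_gt0.
by apply: avg_obj_convex f_convex => //; exact: dim_gt0.
Qed.

Lemma blk_E_gradf v i : blk (E *m gradf f v) i = \sum_j grad (f j) (blk v j).
Proof.
rewrite blk_kronI; apply: eq_bigr => j _.
by rewrite mxE scale1r blk_stack.
Qed.

Lemma E_gradf_xs : E *m gradf f xs = 0.
Proof.
apply: blk_inj => i; rewrite blk_E_gradf.
have -> : \sum_j grad (f j) (blk xs j) = \sum_j grad (f j) xstar.
  by apply: eq_bigr => j _; rewrite blk_ones.
rewrite (sum_grad f dim_gt0) avg_grad_xstar scaler0.
by apply/matrixP => a b; rewrite !mxE.
Qed.

Lemma E_gradf_lip u v :
  norm2 (E *m gradf f u - E *m gradf f v) <= nR * l * norm2 (u - v).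
Proof.
rewrite -mulmxBr; apply: le_trans (norm2_kronI_ones _) _.
by rewrite -mulrA ler_wpM2l // gradf_lip // ltW.
Qed.

Lemma Yinf_z_err k : norm2 (Yoo *m z k - E *m gradf f (x k)) <= err k.
Proof.
rewrite Yinf_z.
have h := @Yinf_invYt_err _ n p Au pi r sigma p_gt0 Au_ge0 Au_diag_gt0 pi_gt0
  sigma_gt0 sigma_lt1 r_gt0 Y_rate k (gradf f (x k)).
(* The factor [Num.sqrt nR] of [err] is at least 1 because [n] is positive. *)
apply: le_trans h _; rewrite /err -!mulrA; apply: ler_peMl.
  by rewrite !mulr_ge0 ?norm2_ge0 ?exprn_ge0 ?yt_ge0 ?y_ge0 ?ltW.
by rewrite -[leLHS]sqrtr1 ler_wsqrtr // ler1n dim_gt0.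
Qed.

(** The vector splits into its dispersion, the summed gradients and the tracking error. The summed
    gradients vanish at [xs], so the Lipschitz bound measures them by the distance from [x k] to
    [xs]. *)
Lemma norm2_z k : norm2 (z k) <= c * Nz k + nR * l * (c * Nx k + Nv k) + err k.
Proof.
have -> : z k = (z k - Yoo *m z k) + (E *m gradf f (x k) - E *m gradf f xs)
    + (Yoo *m z k - E *m gradf f (x k)).
  rewrite E_gradf_xs subr0; move: (Yoo *m z k) (E *m _) => a b.
  by apply/matrixP => i j; rewrite !mxE; ring.
apply: le_trans (norm2D _ _) _; apply: lerD (Yinf_z_err k).
apply: le_trans (norm2D _ _) _; apply: lerD => //.
apply: le_trans (E_gradf_lip _ _) _; rewrite ler_wpM2l ?mulr_ge0 ?(ltW l_gt0) //.
have -> : x k - xs = (x k - Yoo *m x k) + (Yoo *m x k - xs) by rewrite subrKA.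
by apply: le_trans (norm2D _ _) _; apply: lerD.
Qed.

(** By [Yoo *m A = Yoo] the mixing part has the form contracted by [N_contr], and the step
    [D *m z k] enters through [1%:M - Yoo]. *)
Lemma x_dispersion k : Nx k.+1 <= sigma * Nx k + d * (eps * (abar * norm2 (z k))).
Proof.
rewrite /Nx x_next.
have -> : A *m x k - D *m z k - Yoo *m (A *m x k - D *m z k) =
    (A *m x k - Yoo *m x k) - (1%:M - Yoo) *m (D *m z k).
  rewrite mulmxBr mulmxBl mul1mx (mulmxA Yoo) Yinf_mulA // -/Yoo.
  by apply/matrixP => i j; rewrite !mxE; ring.
apply: le_trans (N_triangle _ _) _; rewrite N_opp; apply: lerD => //.
apply: le_trans (N_disp _) _.
by rewrite ler_pM2l // ler_wpM2l ?mxnorm2_ge0 // norm2_D.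
Qed.

Lemma smooth_ge_convex : mu <= l.
Proof.
apply: (strong_le_smooth (F := avg_obj f) (g := avg_grad f)) => //.
- by apply: avg_grad_lip f_smooth => //; exact: dim_gt0.
- by apply: avg_obj_convex f_convex => //; exact: dim_gt0.
Qed.

(** All blocks agree on both sides, so the factor [Num.sqrt n%:R] is common and one block remains: a
    gradient step on the average objective from [u], with step-size [nR * pia], compared with the
    fixed point [xstar]. *)
Lemma consensus_step k :
  norm2 (Yoo *m x k - xs - pia *: (E *m gradf f (Yoo *m x k))) <= lambda * Nv k.
Proof.
set u := \sum_j pi j 0 *: blk (x k) j.
have bu i : blk (Yoo *m x k) i = u by rewrite blk_Yinf.
have bv i : blk (Yoo *m x k - xs) i = u - xstar by rewrite blkB bu blk_ones.
have bs i : blk (Yoo *m x k - xs - pia *: (E *m gradf f (Yoo *m x k))) i =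
    u - xstar - (nR * pia) *: (avg_grad f u - avg_grad f xstar).
  rewrite blkB bv avg_grad_xstar subr0 mulrC -scalerA -(sum_grad f dim_gt0).
  by rewrite blkZ blk_E_gradf; under eq_bigr do rewrite bu.
rewrite /Nv (norm2_const_blk bv) (norm2_const_blk bs).
rewrite mulrCA ler_wpM2l ?sqrtr_ge0 //.
apply: (gradient_step (F := avg_obj f)) => //.
- by apply: avg_grad_lip f_smooth => //; exact: dim_gt0.
- by apply: avg_obj_convex f_convex => //; exact: dim_gt0.
- exact: smooth_ge_convex.
- by rewrite mulr_ge0 ?pia_ge0 ?ler0n.
Qed.

(** On a vector with equal blocks, averaging the different step-sizes amounts to the single
    step-size [pia]. *)
Lemma Yinf_D_Yinf (v : 'cV_(n * p)) : Yoo *m (D *m (Yoo *m v)) = pia *: (Yoo *m v).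
Proof.
apply: blk_inj => i; rewrite blk_Yinf.
rewrite blkZ pia_sum scaler_suml blk_Yinf; apply: eq_bigr => j _.
by rewrite blk_kronI_diag mxE blk_Yinf scalerA.
Qed.

Lemma x_optimality k : Nv k.+1 <=
  nR * l * c * abar * Nx k + lambda * Nv k + y * c * abar * Nz k + abar * err k.
Proof.
(* Four contributions: the exact gradient step at the average, the gradients moved from the average
   to [x k], the tracking error, and the dispersion of [z k]. *)
have piE : Yoo *m x k.+1 - xs =
    (Yoo *m x k - xs - pia *: (E *m gradf f (Yoo *m x k)))
    + pia *: (E *m gradf f (Yoo *m x k) - E *m gradf f (x k))
    - pia *: (Yoo *m z k - E *m gradf f (x k))
    - Yoo *m (D *m (z k - Yoo *m z k)).
  rewrite x_next !mulmxBr (mulmxA Yoo A) Yinf_mulA // -/Yoo Yinf_D_Yinf.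
  by apply/matrixP => i j; rewrite !mxE; ring.
rewrite /Nv piE.
have := norm2B (Yoo *m x k - xs - pia *: (E *m gradf f (Yoo *m x k))
    + pia *: (E *m gradf f (Yoo *m x k) - E *m gradf f (x k))
    - pia *: (Yoo *m z k - E *m gradf f (x k)))
    (Yoo *m (D *m (z k - Yoo *m z k))).
have := norm2B (Yoo *m x k - xs - pia *: (E *m gradf f (Yoo *m x k))
    + pia *: (E *m gradf f (Yoo *m x k) - E *m gradf f (x k)))
    (pia *: (Yoo *m z k - E *m gradf f (x k))).
have := norm2D (Yoo *m x k - xs - pia *: (E *m gradf f (Yoo *m x k)))
    (pia *: (E *m gradf f (Yoo *m x k) - E *m gradf f (x k))).
have := consensus_step k.
have h1 : norm2 (pia *: (E *m gradf f (Yoo *m x k) - E *m gradf f (x k)))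
    <= abar * (nR * l * (c * Nx k)).
  rewrite norm2Z (ger0_norm pia_ge0); apply: ler_pM; rewrite ?pia_ge0 ?norm2_ge0 ?pia_le //.
  apply: le_trans (E_gradf_lip _ _) _; rewrite ler_wpM2l ?mulr_ge0 ?(ltW l_gt0) //.
  by rewrite norm2C.
have h2 : norm2 (pia *: (Yoo *m z k - E *m gradf f (x k))) <= abar * err k.
  rewrite norm2Z (ger0_norm pia_ge0).
  by apply: ler_pM; rewrite ?pia_ge0 ?norm2_ge0 ?pia_le ?Yinf_z_err.
have h3 : norm2 (Yoo *m (D *m (z k - Yoo *m z k))) <= y * (abar * (c * Nz k)).
  apply: le_trans (mxnorm2_ub _ _) _; apply: ler_pM; rewrite ?mxnorm2_ge0 ?norm2_ge0 //.
    exact: mxnorm2_Yinf_le Y_rate.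
  by apply: le_trans (norm2_D _) _; rewrite ler_wpM2l ?abar_ge0.
rewrite /Nv; lra.
Qed.

(** [A - 1%:M] annihilates the image of [Yoo], so [tau] multiplies only the dispersion of [x k]. *)
Lemma x_increment k : norm2 (x k.+1 - x k) <= tau * (c * Nx k) + abar * norm2 (z k).
Proof.
have -> : x k.+1 - x k = (A - 1%:M) *m (x k - Yoo *m x k) - D *m z k.
  rewrite x_next mulmxBl !mulmxBr !mul1mx (mulmxA A) mulA_Yinf // -/Yoo.
  by apply/matrixP => i j; rewrite !mxE; ring.
apply: le_trans (norm2B _ _) _; apply: lerD (norm2_D _).
by apply: le_trans (mxnorm2_ub _ _) _; rewrite ler_wpM2l ?mxnorm2_ge0.
Qed.

Lemma z_dispersion k : Nz k.+1 <= sigma * Nz k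
  + d * (eps * (yt * (l * (tau * (c * Nx k) + abar * norm2 (z k)))
         + 2 * (Num.sqrt nR * r * yt ^+ 2 * sigma ^+ k * norm2 (gradf f (x k))))).
Proof.
rewrite /Nz z_next; set q := W k.+1 *m _; set q' := W k *m _.
have -> : A *m z k + q - q' - Yoo *m (A *m z k + q - q') =
    (A *m z k - Yoo *m z k) + (1%:M - Yoo) *m (q - q').
  rewrite -[A *m z k + q - q']addrA mulmxDr (mulmxA Yoo) Yinf_mulA // -/Yoo mulmxBl mul1mx.
  by apply/matrixP => i j; rewrite !mxE; ring.
apply: le_trans (N_triangle _ _) _; apply: lerD => //.
apply: le_trans (N_disp _) _; rewrite ler_pM2l // ler_wpM2l ?mxnorm2_ge0 //.
(* The gradient changes under the new weights, then the weights change at the old gradient. *)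
have -> : q - q' = W k.+1 *m (gradf f (x k.+1) - gradf f (x k))
    + (W k.+1 *m gradf f (x k) - W k *m gradf f (x k)).
  by rewrite mulmxBr subrKA.
apply: le_trans (norm2D _ _) _; apply: lerD.
  apply: le_trans (mxnorm2_ub _ _) _; apply: ler_pM; rewrite ?mxnorm2_ge0 ?norm2_ge0 //.
    by apply: mxnorm2_Yt_le Y_rate _.
  apply: le_trans (gradf_lip _ _ (ltW l_gt0) f_smooth) _.
  by rewrite ler_pM2l // x_increment.
have h := @invYt_diff _ n p Au pi r sigma p_gt0 Au_ge0 Au_diag_gt0 pi_gt0
  sigma_gt0 sigma_lt1 r_gt0 Y_rate k.+1 k (gradf f (x k)).
apply: le_trans h _; rewrite -/yt.
set G := norm2 _; have G0 : 0 <= G by exact: norm2_ge0.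
have s0 : 0 <= r * sigma ^+ k by rewrite mulr_ge0 ?exprn_ge0 // ltW.
(* The factor 2 arises from [sigma ^+ k.+1 <= sigma ^+ k]. *)
have rs : r * sigma ^+ k.+1 + r * sigma ^+ k <= 2 * (r * sigma ^+ k).
  by rewrite exprS mulrCA; have := ler_piMl s0 (ltW sigma_lt1); lra.
have n1 : 1 <= Num.sqrt nR by rewrite -[leLHS]sqrtr1 ler_wsqrtr // ler1n dim_gt0.
have Y0 : 0 <= yt ^+ 2 * G by rewrite mulr_ge0 ?sqr_ge0.
have := ler_wpM2r Y0 rs.
have := ler_peMl (mulr_ge0 s0 Y0) n1.
lra.
Qed.

(** * The three recursions with coefficients collected *)

Let G k := norm2 (gradf f (x k)).

(** The bound [norm2_z] eliminates [norm2 (z k)] from [x_dispersion]. *)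
Lemma x_dispersion_row k : Nx k.+1 <=
  (sigma + c * d * eps * nR * l * abar) * Nx k + d * eps * nR * l * abar * Nv k
  + c * d * eps * abar * Nz k
  + sigma ^+ k * (abar * d * eps * Num.sqrt nR * r * y * yt ^+ 2 * G k).
Proof.
have q0 : 0 <= d * eps * abar by rewrite !mulr_ge0 ?mxnorm2_ge0 ?abar_ge0 ?ltW.
have := ler_wpM2l q0 (norm2_z k); have := x_dispersion k.
rewrite /err /G; lra.
Qed.

Lemma x_optimality_row k : Nv k.+1 <=
  c * nR * l * abar * Nx k + lambda * Nv k + y * c * abar * Nz k
  + sigma ^+ k * (abar * Num.sqrt nR * r * y * yt ^+ 2 * G k).
Proof. have := x_optimality k; rewrite /err /G; lra. Qed.

(** In the last coefficient, 2 comes from the change of weights and [abar * l * y * yt] from the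
    tracking error inside [norm2_z]. *)
Lemma z_dispersion_row k : Nz k.+1 <=
  (eps * yt * l * tau * c * d + c * d * nR * l ^+ 2 * eps * yt * abar) * Nx k
  + d * nR * l ^+ 2 * eps * yt * abar * Nv k
  + (sigma + c * d * eps * l * yt * abar) * Nz k
  + sigma ^+ k
    * (d * Num.sqrt nR * r * eps * yt ^+ 2 * (2 + abar * l * y * yt) * G k).
Proof.
have q0 : 0 <= d * eps * yt * l * abar.
  by rewrite !mulr_ge0 ?mxnorm2_ge0 ?abar_ge0 ?yt_ge0 ?ltW.
have := ler_wpM2l q0 (norm2_z k); have := z_dispersion k.
rewrite /err /G; lra.
Qed.

End Frost.

(** * Step-size conditions and the proof of both claims *)

(** For [w = 0] the quotient is [+oo], 0 or [-oo] according to the sign of [u]; exceeding [v >= 0]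
    leaves only [u > 0], which is then the conclusion. *)
Lemma lte_div_mul (R : realType) (u v w : R) : 0 <= v -> 0 <= w ->
  (v%:E < u%:E / w%:E)%E -> v * w < u.
Proof.
move=> v0; rewrite le_eqVlt inver => /predU1P[<-|w0]; last first.
  by rewrite gt_eqF // -EFinM lte_fin ltr_pdivlMr.
rewrite eqxx mulr0; have [u0|//|->] := ltrgtP u 0.
  by rewrite lt0_muley ?lte_fin.
by rewrite mul0e lte_fin ltNge v0.
Qed.

Lemma min_entry_gt0 (R : realType) (n : nat) (v : 'cV[R]_n) :
  (forall i, 0 < v i 0) -> 0 < min_entry v.
Proof. by move=> v0; apply: lt_bigmin. Qed.

(** Each term [v i 0 * w i 0] alone bounds the nonnegative sum from below. This turns the largest
    step-size into a lower bound for [pia]. *)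
Lemma max_entry_le_dot (R : realType) (n : nat) (v w : 'cV[R]_n) :
  (forall i, 0 < v i 0) -> (forall i, 0 <= w i 0) ->
  min_entry v * max_entry w <= (v^T *m w) 0 0.
Proof.
move=> v0 w0; have m0 := min_entry_gt0 v0.
rewrite mulrC -ler_pdivlMr // dotE; apply: bigmax_le => [|i _].
  rewrite divr_ge0 ?(ltW m0) // sumr_ge0 // => j _; rewrite mulr_ge0 //; exact: ltW.
rewrite ler_pdivlMr // /dot (bigD1 i) //= mulrC ler_wpDr //.
  by rewrite sumr_ge0 // => j _; rewrite mulr_ge0 // ltW.
by rewrite ler_wpM2r //; exact: (bigmin_le _ i (fun j => v j 0)).
Qed.


Theorem theorem1 (R : realType) (n p : nat) (p_gt0 : (0 < p)%N)
  (* the communication graph *)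
  (Nin : 'I_n -> {set 'I_n})
  (Nin_refl : forall i, i \in Nin i)
  (Nin_connected : forall i j, connect [rel u v | u \in Nin v] i j)
  (* the objective functions *)
  (f : 'I_n -> 'cV[R]_p -> R) (l mu : R)
  (l_gt0 : 0 < l) (mu_gt0 : 0 < mu)
  (f_diff : forall i x, differentiable (f i) x)
  (f_smooth : forall i x y,
     norm2 (grad (f i) x - grad (f i) y) <= l * norm2 (x - y))
  (f_convex : forall i x y,
     f i y >= f i x + ((grad (f i) x)^T *m (y - x)) 0 0
              + mu / 2 * norm2 (x - y) ^+ 2)
  (xstar : 'cV[R]_p)
  (xstar_min : forall x, avg_obj f xstar <= avg_obj f x)
  (* the weights and the left Perron vector *)
  (Au : 'M[R]_n)
  (Au_stoch : forall i, \sum_j Au i j = 1)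
  (Au_pos : forall i j, j \in Nin i -> 0 < Au i j)
  (Au_zero : forall i j, j \notin Nin i -> Au i j = 0)
  (pi_r : 'cV[R]_n)
  (pi_pos : forall i, 0 < pi_r i 0)
  (pi_left : pi_r^T *m Au = pi_r^T)
  (pi_sum : pi_r^T *m (const_mx 1 : 'cV[R]_n) = 1%:M)
  (* the step-sizes and the initial point *)
  (alpha : 'cV[R]_n) (alpha_ge0 : forall i, 0 <= alpha i 0)
  (x0 : 'cV[R]_(n * p))
  (* the contraction norm and the constants *)
  (N : 'cV[R]_(n * p) -> R) (N_norm : is_vector_norm N)
  (sigma : R) (sigma_gt0 : 0 < sigma) (sigma_lt1 : sigma < 1)
  (N_contr : forall a, N (kronI p Au *m a - Yinf p pi_r *m a)
                       <= sigma * N (a - Yinf p pi_r *m a))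
  (r : R) (r_gt0 : 0 < r)
  (Y_rate : forall k, mxnorm2 (Ymx p Au k - Yinf p pi_r) <= r * sigma ^+ k)
  (c d : R) (c_gt0 : 0 < c) (d_gt0 : 0 < d)
  (norm2_le : forall v, norm2 v <= c * N v)
  (N_le : forall v, N v <= d * norm2 v) :
  let nR : R := n%:R in
  let A := kronI p Au in
  let Yoo := Yinf p pi_r in
  let tau := mxnorm2 (A - 1%:M) in
  let eps := mxnorm2 (1%:M - Yoo) in
  let y := sup [set mxnorm2 (Ymx p Au k) | k in [set: nat]] in
  let yt := sup [set mxnorm2 (invmx (Yt p Au k)) | k in [set: nat]] in
  let abar := max_entry alpha in
  let pia := (pi_r^T *m alpha) 0 0 in
  let a1 := c * d * eps * nR * l in
  let a2 := d * eps * nR * l in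
  let a3 := c * d * eps in
  let a4 := c * nR * l in
  let a5 := y * c in
  let a6 := eps * yt * l * tau * c * d in
  let a7 := c * d * nR * l ^+ 2 * eps * yt in
  let a8 := d * nR * l ^+ 2 * eps * yt in
  let a9 := c * d * eps * l * yt in
  let lambda := Num.max `|1 - nR * pia * mu| `|1 - nR * pia * l| in
  let x := frost_x Au f alpha x0 in
  let z := frost_z Au f alpha x0 in
  let t k := col3 (N (x k - Yoo *m x k))
                  (norm2 (Yoo *m x k - (const_mx 1 : 'cV[R]_n) *t xstar))
                  (N (z k - Yoo *m z k)) in
  let J := mx33
    (col3 (sigma + a1 * abar) (a2 * abar) (a3 * abar))
    (col3 (a4 * abar)         lambda      (a5 * abar))
    (col3 (a6 + a7 * abar)    (a8 * abar) (sigma + a9 * abar)) in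
  let H k := sigma ^+ k *: mx33
    (col3 (abar * d * eps * Num.sqrt nR * r * y * yt ^+ 2) 0 0)
    (col3 (abar * Num.sqrt nR * r * y * yt ^+ 2) 0 0)
    (col3 (d * Num.sqrt nR * r * eps * yt ^+ 2 * (2 + abar * l * y * yt)) 0 0) in
  let s k := col3 (norm2 (gradf f (x k))) 0 0 in
  (pia < 2 / (nR * l) ->
     forall k i, t k.+1 i 0 <= (J *m t k + H k *m s k) i 0)
  /\
  (* The quotients are taken in the extended reals, where v / 0 = +oo for
     v > 0: the denominators a6, etc., vanish when n = 1. *)
  (forall delta1 delta2 delta3 : R,
     0 < delta1 -> 0 < delta2 -> 0 < delta3 ->
     (delta1%:E < ((1 - sigma) * delta3)%:E / a6%:E)%E ->
     delta2 > (a4 * delta1 + a5 * delta3) / (mu * nR * min_entry pi_r) ->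
     0 < abar ->
     (abar%:E < Order.min
        ((delta1 * (1 - sigma))%:E
           / (a1 * delta1 + a2 * delta2 + a3 * delta3)%:E)
        (Order.min
           (((1 - sigma) * delta3 - delta1 * a6)%:E
              / (a7 * delta1 + a8 * delta2 + a9 * delta3)%:E)
           (1 / (nR * l))%:E))%E ->
     spectral_radius J < 1).
Proof.
have Au_ge0 i j : 0 <= Au i j.
  by have [/Au_pos/ltW//|/Au_zero->] := boolP (j \in Nin i).
have Au_diag_gt0 i : 0 < Au i i by exact: Au_pos.
move=> nR A Yoo tau eps y yt abar pia a1 a2 a3 a4 a5 a6 a7 a8 a9 lambda x z t J H s.
split=> [_ k i|delta1 delta2 delta3 d1 d2 d3 hd1 hd2 abar_gt0].
  (* Only the first column of [H k] meets the nonzero entry of [s k], so three scalar inequalities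
     remain. *)
  rewrite /t /J /H /s -scalemxAl !mx33_mul !mul0r !addr0 col3Z col3D.
  apply: col3_le.
  - exact: (x_dispersion_row p_gt0 l_gt0 mu_gt0 f_smooth f_convex xstar_min
      Au_ge0 Au_diag_gt0 pi_pos pi_left pi_sum sigma_gt0 sigma_lt1 r_gt0 Y_rate x0 alpha_ge0 N_norm
      N_contr d_gt0 norm2_le N_le).
  - exact: (x_optimality_row p_gt0 l_gt0 mu_gt0 f_smooth f_convex xstar_min
      Au_ge0 Au_diag_gt0 pi_pos pi_left pi_sum sigma_gt0 sigma_lt1 r_gt0 Y_rate x0 alpha_ge0 norm2_le).
  - exact: (z_dispersion_row p_gt0 l_gt0 mu_gt0 f_smooth f_convex xstar_min
      Au_ge0 Au_diag_gt0 Au_stoch pi_pos pi_left pi_sum sigma_gt0 sigma_lt1 r_gt0 Y_rate x0 alpha_ge0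
      N_norm N_contr d_gt0 norm2_le N_le).
have n_gt0 : 0 < nR by rewrite ltr0n (dim_gt0 pi_sum).
have eps0 : 0 <= eps by exact: mxnorm2_ge0.
have tau0 : 0 <= tau by exact: mxnorm2_ge0.
have y0 : 0 <= y by exact: (y_ge0 sigma_gt0 sigma_lt1 r_gt0 Y_rate).
have yt0 : 0 <= yt.
  exact: (yt_ge0 p_gt0 Au_ge0 Au_diag_gt0 pi_pos sigma_gt0 sigma_lt1 Y_rate).
have mu_le : mu <= l by exact: (smooth_ge_convex p_gt0 f_smooth f_convex pi_sum).
have pia_abar : pia <= abar by exact: pia_le.
have m0 : 0 < min_entry pi_r by exact: min_entry_gt0.
have pia_min : min_entry pi_r * abar <= pia by exact: max_entry_le_dot.
have [l0 mu0 c0 d0 s0] : [/\ 0 <= l, 0 <= mu, 0 <= c, 0 <= d & 0 <= sigma].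
  by split; exact: ltW.
have ab0 := ltW abar_gt0; have n0 := ltW n_gt0.
have a1_0 : 0 <= a1 by rewrite !mulr_ge0.
have a2_0 : 0 <= a2 by rewrite !mulr_ge0.
have a3_0 : 0 <= a3 by rewrite !mulr_ge0.
have a4_0 : 0 <= a4 by rewrite !mulr_ge0.
have a5_0 : 0 <= a5 by rewrite !mulr_ge0.
have a6_0 : 0 <= a6 by rewrite !mulr_ge0.
have a7_0 : 0 <= a7 by rewrite !mulr_ge0.
have a8_0 : 0 <= a8 by rewrite !mulr_ge0.
have a9_0 : 0 <= a9 by rewrite !mulr_ge0.
have lambda0 : 0 <= lambda by rewrite le_max normr_ge0.
(* From here on only the signs of these constants matter. *)
clearbody a1 a2 a3 a4 a5 a6 a7 a8 a9.
have [d1' d2' d3'] := And3 (ltW d1) (ltW d2) (ltW d3).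
rewrite !lt_min => /and3P[/lte_div_mul h1 /lte_div_mul h2].
rewrite lte_fin ltr_pdivlMr ?mulr_gt0 // mulrC => nabar.
have {}h1 : abar * (a1 * delta1 + a2 * delta2 + a3 * delta3) < delta1 * (1 - sigma).
  by apply: h1 => //; rewrite !addr_ge0 ?mulr_ge0.
have {}h2 : abar * (a7 * delta1 + a8 * delta2 + a9 * delta3)
    < (1 - sigma) * delta3 - delta1 * a6.
  by apply: h2 => //; rewrite !addr_ge0 ?mulr_ge0.
have mn0 : 0 < mu * nR * min_entry pi_r by rewrite !mulr_gt0.
move: hd2; rewrite ltr_pdivrMr // => hd2.
(* As [pia <= abar < 1 / (nR * l)] and [mu <= l], both quantities under absolute values are
   nonnegative and the one with [mu] dominates. *)
have lambda_le : lambda <= 1 - nR * pia * mu.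
  have pia0 : 0 <= pia by apply: le_trans pia_min; rewrite mulr_ge0 // ltW.
  have q1 : nR * pia * l < 1.
    by apply: le_lt_trans nabar; rewrite mulrAC ler_wpM2l // mulr_ge0.
  have q2 : nR * pia * mu <= nR * pia * l by rewrite ler_wpM2l // mulr_ge0.
  rewrite ge_max !ger0_norm ?subr_ge0 ?(ltW q1) ?(le_trans q2 (ltW q1)) //.
  by rewrite lexx lerD2l lerN2.
(* Rows one and three decrease by the first two bounds on [abar]. *)
apply: (spectral_radius_lt1 (w := col3 delta1 delta2 delta3)).
- by move=> [[|[|[|]]] //= ?] [[|[|[|]]] //= ?]; rewrite !mxE /= ?addr_ge0 ?mulr_ge0.
- by move=> [[|[|[|]]] //= ?]; rewrite mxE.
rewrite /J mx33_mul => -[[|[|[|]]] //= ?]; rewrite !mxE /=.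
- lra.
(* Here [lambda * delta2] falls short of [delta2] by at least [abar * delta2 * (mu * nR * min_entry
   pi_r)], which the lower bound on [delta2] makes larger than the off-diagonal contribution. *)
- have := ler_wpM2r d2' lambda_le.
  have := ler_wpM2l (mulr_ge0 (mulr_ge0 n0 mu0) d2') pia_min.
  have : abar * (a4 * delta1 + a5 * delta3)
      < abar * (delta2 * (mu * nR * min_entry pi_r)) by rewrite ltr_pM2l.
  lra.
- lra.
Qed.
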